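(* For every integer $d\ge 0$ there exist $\alpha_1,\dots,\alpha_{d+1}\in\mathbb{R}$ and $a_1,\dots,a_{d+1}\in(0,1)$ such that $$(x+1)^{2d+2}-x^{2d+2}=\sum_{i=1}^{d+1}\alpha_i (x-a_i)^{2d+1}.$$ In particular, for every integer $s\ge 3$ there is a linearly dependent family of $s$ pairwise distinct real shifted powers all of whose exponents are at least $2s-5$ (take $s=d+3$).
   Context: A real shifted power is a polynomial of the form $(x-a)^e$ with $a\in\mathbb{R}$ and $e\in\mathbb{N}$; $e$ is its exponent. Linear dependence is over $\mathbb{R}$.
   Formalization: The interval (0,1) for the a_i is replaced by (-1,0): as printed the identity fails already for d=0, where 2x+1=α(x-a) forces a=-1/2; equivalently, one keeps a_i in (0,1) and writes (x+a_i)^{2d+1}. *)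

(* Defs.v *)
From mathcomp Require Import all_boot all_order all_algebra.
From mathcomp Require Import reals.

Set Implicit Arguments.
Unset Strict Implicit.
Unset Printing Implicit Defensive.

Import Order.TTheory GRing.Theory Num.Theory.
Local Open Scope ring_scope.

Definition shifted_power (R : realType) (a : R) (e : nat) : {poly R} :=
  ('X - a%:P) ^+ e.

(* MathComp's [free] needs a finite-dimensional [vectType], which {poly R}
   is not; the family is indexed, so a repeated member makes it dependent. *)
Definition linearly_dependent (R : nzRingType) (V : lmodType R) (n : nat)
    (v : 'I_n -> V) : Prop :=
  exists2 c : 'I_n -> R,
    (exists i, c i != 0) & \sum_(i < n) c i *: v i = 0.

(* Main.v *)
From HB Require Import structures.
Require Import Defs.
From mathcomp Require Import all_boot all_order all_algebra.
From mathcomp Require Import reals.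
From mathcomp Require Import qpoly polyrcf.

Set Implicit Arguments.
Unset Strict Implicit.
Unset Printing Implicit Defensive.

Import Order.TTheory GRing.Theory Num.Theory.
Local Open Scope ring_scope.

(** The left-hand side is [2d+2] times the integral over [-1, 0] of
    [t |-> (x - t)^(2d+1)], and an [n]-point Gauss quadrature rule is exact on
    polynomials of degree at most [2n - 1].  With [n = d+1] the rule computes
    this integral exactly from the values [(x - a_i)^(2d+1)] at its nodes
    [a_i], which lie in the open interval [(-1, 0)] ([gauss_quadrature],
    [shifted_power_difference]).

    The rule is built by algebra.  Its nodes are the roots of the shifted
    Legendre polynomial, given by Rodrigues' formula as the [n]-th derivative
    of [((X - a)(X - b))^n].  Repeated use of Rolle's theorem gives [n] distinct
    roots in [(a, b)] ([rodrigues_roots]), and repeated integration by parts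
    gives orthogonality to polynomials of degree less than [n]
    ([rodrigues_orthogonal]).  For [p] of degree less than [2n], divide by the
    Legendre polynomial: the quotient contributes nothing to the integral nor
    to the values at the nodes, and the remainder has degree less than [n], so
    it is recovered by Lagrange interpolation at the nodes.

    Moving everything to one side, the identity is a linear relation between
    [d+3] shifted powers with exponents [2d+1] and [2d+2]; they are distinct
    because the shifts [a_i], [-1], [0] are. *)

(** * Integrals of polynomials *)

Section Primitive.
Variable K : numFieldType.
Implicit Types (p q : {poly K}) (a b : K).

(** The constant coefficient is [p`_0 / 0 = 0], so this is the primitive
    that vanishes at 0. *)
Definition primitive p : {poly K} :=
  \poly_(i < (size p).+1) (p`_i.-1 / i%:R).

Lemma coef_primitive p i : (primitive p)`_i = p`_i.-1 / i%:R.
Proof.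
rewrite coef_poly; case: ltnP => // le_p_i.
by rewrite nth_default ?mul0r // -ltnS (leq_trans le_p_i) ?leqSpred.
Qed.

Lemma primitive_is_linear : linear primitive.
Proof.
move=> c p q; apply/polyP=> i.
by rewrite coefD coefZ !coef_primitive coefD coefZ mulrDl mulrA.
Qed.

HB.instance Definition _ :=
  GRing.isLinear.Build K {poly K} {poly K} _ primitive primitive_is_linear.

Lemma primitive_deriv p : primitive p^`() = p - (p`_0)%:P.
Proof.
apply/polyP=> -[|i]; rewrite coef_primitive coefB coefC /=.
  by rewrite invr0 mulr0 subrr.
by rewrite coef_deriv subr0 -[X in X / _]mulr_natr mulfK ?pnatr_eq0.
Qed.

Definition integral a b p := (primitive p).[b] - (primitive p).[a].

Lemma integral_is_scalar a b : scalar (integral a b).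
Proof.
move=> c p q; rewrite /integral linearP /= !hornerD !hornerZ.
by rewrite opprD addrACA mulrBr.
Qed.

HB.instance Definition _ a b :=
  GRing.isLinear.Build K {poly K} K _ (integral a b) (integral_is_scalar a b).

Lemma integral_deriv a b p : integral a b p^`() = p.[b] - p.[a].
Proof. by rewrite /integral primitive_deriv !hornerE opprB addrA subrK. Qed.

Lemma integral_by_parts a b p q :
  integral a b (p^`() * q) =
  p.[b] * q.[b] - p.[a] * q.[a] - integral a b (p * q^`()).
Proof.
by apply/eqP; rewrite eq_sym subr_eq -raddfD -derivM /= integral_deriv !hornerM.
Qed.

End Primitive.

(** * Legendre polynomials by Rodrigues' formula *)

Lemma size_derivn (R : realDomainType) (p : {poly R}) n :
  size p^`(n) = (size p - n)%N.
Proof.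
elim: n => [|n IHn]; first by rewrite subn0.
by rewrite derivnS polyorder.size_deriv IHn subnS.
Qed.

(** Each differentiation lowers the multiplicity of a root by at most one. *)
Lemma root_derivn_exp (R : idomainType) (p : {poly R}) a n k :
  (k < n)%N -> root p a -> root (p ^+ n)^`(k) a.
Proof.
move=> lt_kn pa0.
have [q ->] : exists q, (p ^+ n)^`(k) = q * p ^+ (n - k).
  elim: k lt_kn => [|k IHk] lt_kn; first by exists 1; rewrite subn0 mul1r.
  have [q eq_k] := IHk (ltnW lt_kn).
  exists (q^`() * p + q * p^`() *+ (n - k)).
  rewrite derivnS eq_k derivM deriv_exp -(subnSK (ltnW lt_kn)) /= exprS.
  by rewrite mulrDl mulrA mulrnAl mulrnAr mulrA.
by rewrite rootE hornerM horner_exp (rootP pa0) expr0n subn_eq0 leqNgt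
  lt_kn mulr0.
Qed.

Section Rodrigues.
Variables (R : rcfType) (a b : R).
Implicit Types (p q : {poly R}) (s : seq R).

Let w : {poly R} := ('X - a%:P) * ('X - b%:P).

Let root_w_a : root w a.
Proof. by rewrite rootM root_XsubC eqxx. Qed.

Let root_w_b : root w b.
Proof. by rewrite rootM orbC root_XsubC eqxx. Qed.

(** Up to a scalar, the [n]-th Legendre polynomial transported to [[a, b]]. *)
Definition rodrigues n : {poly R} := (w ^+ n)^`(n).

Lemma size_rodrigues n : size (rodrigues n) = n.+1.
Proof.
rewrite size_derivn; set u := w ^+ n.
have u_monic : u \is monic by rewrite monic_exp ?monicMl ?monicXsubC.
rewrite -(prednK (n := size u)) ?size_poly_gt0 ?monic_neq0 //.
rewrite size_exp size_monicM ?monicXsubC ?polyXsubC_eq0 // !size_XsubC /=.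
by rewrite mul2n -addnn -addSn addnK.
Qed.

(** Each integration by parts moves one derivative onto [q]; no boundary term
    appears, as [w ^+ n] vanishes to order [n] at both ends, and a polynomial
    of degree less than [n] does not survive [n] derivatives. *)
Lemma rodrigues_orthogonal n q :
  (size q <= n)%N -> integral a b (rodrigues n * q) = 0.
Proof.
rewrite /rodrigues; move: {1 3 4}n (leqnn n) => k.
elim: k q => [|k IHk] q le_kn.
  by rewrite leqn0 size_poly_eq0 => /eqP ->; rewrite mulr0 linear0.
move=> le_qk; rewrite derivnS integral_by_parts IHk ?(ltnW le_kn) //; last first.
  by rewrite polyorder.size_deriv -subn1 leq_subLR add1n.
rewrite (rootP (root_derivn_exp le_kn root_w_a)).
by rewrite (rootP (root_derivn_exp le_kn root_w_b)) !mul0r !subrr.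
Qed.

(** Rolle's theorem between consecutive terms of an increasing sequence of
    roots. *)
Lemma rolle_path p x s :
    path <%R x (rcons s b) -> all (root p) (x :: rcons s b) ->
  exists2 s', size s' = (size s).+1 &
    path <%R x (rcons s' b) && all (root p^`()) s'.
Proof.
elim: s x => [|y s IHs] x /=.
  rewrite andbT => lt_xb /and3P[/rootP px0 /rootP pb0 _].
  have [c] := poly_rolle lt_xb (etrans px0 (esym pb0)).
  rewrite in_itv /= => /andP[lt_xc lt_cb] /rootP p'c0.
  by exists [:: c]; rewrite //= lt_xc lt_cb p'c0.
case/andP=> lt_xy y_s /and3P[/rootP px0 /rootP py0 p_s].
have [|s' size_s' /andP[y_s' p'_s']] := IHs y y_s.
  by rewrite /= p_s andbT; apply/rootP.
have [c] := poly_rolle lt_xy (etrans px0 (esym py0)).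
rewrite in_itv /= => /andP[lt_xc lt_cy] /rootP p'c0.
exists (c :: s') => /=; first by rewrite size_s'.
rewrite lt_xc p'c0 p'_s' !andbT /=.
by case: {size_s' p'_s'} s' y_s' => [|z s'] /= /andP[lt_yz path_z];
  rewrite (lt_trans lt_cy lt_yz).
Qed.

Lemma rodrigues_roots n : a < b ->
  exists2 s, size s = n &
    path <%R a (rcons s b) && all (root (rodrigues n)) s.
Proof.
move=> lt_ab; rewrite /rodrigues; move: {1 3 4}n (leqnn n) => k.
elim: k => [|k IHk] lt_kn; first by exists [::]; rewrite //= lt_ab.
have [s size_s /andP[a_s w_s]] := IHk (ltnW lt_kn).
have [|s' size_s' s'_p] := rolle_path (p := (w ^+ n)^`(k)) a_s; last first.
  by exists s'; rewrite ?size_s' ?size_s ?derivnS.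
by rewrite /= all_rcons w_s !root_derivn_exp.
Qed.

(** Lagrange interpolation asks for sampling points indexed by all of [nat],
    so the roots are continued injectively beyond [b]. *)
Lemma rodrigues_nodes n : a < b ->
  exists2 x : nat -> R, injective x &
    forall i, (i < n)%N -> (a < x i < b) && root (rodrigues n) (x i).
Proof.
move=> lt_ab; have [s size_s /andP[a_s w_s]] := rodrigues_roots n lt_ab.
have [s_uniq s_in] : uniq s /\ {in s, forall y, a < y < b}.
  move: a_s; rewrite lt_path_sortedE all_rcons lt_sorted_pairwise pairwise_rcons.
  case/and3P=> /andP[_ /allP gt_s] /allP lt_s s_sorted.
  split; first by rewrite lt_sorted_uniq // lt_sorted_pairwise.
  by move=> y s_y; rewrite gt_s //= lt_s.
have {}s_in i : (i < n)%N -> a < s`_i < b.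
  by rewrite -size_s => lt_is; rewrite s_in // mem_nth.
pose x i := if (i < n)%N then s`_i else b + i%:R.
have x_ge i : (n <= i)%N -> b <= x i.
  by move=> le_ni; rewrite /x ltnNge le_ni lerDl ler0n.
have x_lt i : (i < n)%N -> x i = s`_i by rewrite /x => ->.
exists x => [i j|i lt_in]; last first.
  by rewrite x_lt // s_in // (all_nthP 0 w_s) ?size_s.
case: (ltnP i n) => [lt_in|le_ni]; case: (ltnP j n) => [lt_jn|le_nj] eq_x.
- apply/eqP; rewrite -(nth_uniq 0 _ _ s_uniq) ?size_s //.
  by rewrite -(x_lt i) // eq_x x_lt.
- have /andP[_] := s_in i lt_in.
  by rewrite ltNge -x_lt // eq_x x_ge.
- have /andP[_] := s_in j lt_jn.
  by rewrite ltNge -x_lt // -eq_x x_ge.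
move: eq_x; rewrite /x !ltnNge le_ni le_nj => /addrI.
by apply: mulrIn; rewrite oner_eq0.
Qed.

(** * Gauss quadrature *)

(** The weights are the integrals of the Lagrange polynomials at the nodes.
    This alone makes the rule exact in degree less than [n]; the choice of the
    nodes as roots of the Legendre polynomial, and its orthogonality, double
    that range. *)
Lemma gauss_quadrature n : a < b ->
  exists2 x : nat -> R,
    injective x /\ (forall i, (i < n)%N -> a < x i < b) &
    exists c : nat -> R, forall p, (size p <= 2 * n)%N ->
      integral a b p = \sum_(i < n) c i * p.[x i].
Proof.
move=> lt_ab; have [x x_inj x_node] := rodrigues_nodes n lt_ab.
exists x; first by split=> // i /x_node /andP[].
exists (fun i => integral a b (val ((n.-lagrange x)`_i))) => p le_p.
case: (posnP n) le_p => [->|n_gt0] le_p.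
  move: le_p; rewrite muln0 leqn0 size_poly_eq0 => /eqP ->.
  by rewrite linear0 big_ord0.
have v_neq0 : rodrigues n != 0 by rewrite -size_poly_eq0 size_rodrigues.
set q := p %/ rodrigues n; set r := p %% rodrigues n.
have def_p : p = rodrigues n * q + r by rewrite mulrC; apply: divp_eq.
have le_q : (size q <= n)%N.
  by rewrite size_divp // size_rodrigues /= leq_subLR addnn -mul2n.
have le_r : (size r <= n)%N.
  by rewrite -ltnS -(size_rodrigues n) ltn_modp.
have p_x (i : 'I_n) : p.[x i] = r.[x i].
  have /andP[_ /rootP v0] := x_node i (ltn_ord i).
  by rewrite def_p hornerD hornerM v0 mul0r add0r.
rewrite {1}def_p linearD /= rodrigues_orthogonal // add0r.
rewrite {1}(lagrange_gen n_gt0 x_inj le_r) linear_sum /=.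
apply: eq_bigr => i _.
by rewrite mul_polyC linearZ /= nth_lagrange p_x mulrC.
Qed.

End Rodrigues.

(** * Shifted powers *)

Lemma horner_inj (R : numDomainType) (p q : {poly R}) :
  (forall x, p.[x] = q.[x]) -> p = q.
Proof.
move=> eq_pq; apply/eqP; rewrite -subr_eq0; apply/eqP.
apply: (@roots_geq_poly_eq0 _ _ (mkseq (fun i => i%:R) (size (p - q)))).
- by apply/allP=> x _; rewrite rootE !hornerE eq_pq subrr.
- by rewrite mkseq_uniq //; apply: mulrIn; rewrite oner_eq0.
- by rewrite size_mkseq.
Qed.

(** For each value [y] of the variable, the quadrature rule is applied to
    [t |-> (y - t)^(2d+1)], whose primitive is [- (y - t)^(2d+2) / (2d+2)]. *)
Lemma shifted_power_difference (R : realType) d :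
  exists2 x : nat -> R,
    injective x /\ (forall i, (i < d.+1)%N -> -1 < x i < 0) &
    exists c : nat -> R,
      ('X + 1) ^+ (2 * d + 2) - 'X ^+ (2 * d + 2) =
        \sum_(i < d.+1) c i *: shifted_power (x i) (2 * d + 1).
Proof.
have [|x x_node [c quad]] := @gauss_quadrature R (-1) 0 d.+1.
  by rewrite oppr_lt0 ltr01.
exists x => //; exists (fun i => (2 * d + 2)%:R * c i); apply: horner_inj => y.
pose f : {poly R} := y%:P - 'X.
have size_f : (size (f ^+ (2 * d + 1)) <= 2 * d.+1)%N.
  rewrite (leq_trans (size_poly_exp_leq _ _)) // /f -opprB size_polyN size_XsubC.
  by rewrite mul1n mulnS addn1 add2n.
have deriv_f : (f ^+ (2 * d + 2))^`() = - (2 * d + 2)%:R *: f ^+ (2 * d + 1).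
  rewrite deriv_exp derivB derivC derivX sub0r mulN1r mulNrn scaleNr.
  by rewrite scaler_nat addnS.
have := integral_deriv (-1) 0 (f ^+ (2 * d + 2)).
rewrite deriv_f linearZ /= quad // !hornerE subr0 opprK => /esym eq_y.
rewrite -[LHS]opprK opprB eq_y mulNr opprK horner_sum big_distrr /=.
by apply: eq_bigr => i _; rewrite !hornerE.
Qed.

Lemma shifted_power_inj (R : realType) (a b : R) m n :
  (0 < m)%N -> shifted_power a m = shifted_power b n -> a = b.
Proof.
move=> m_gt0 eq_ab.
have eq_mn : m = n.
  have := congr1 (fun p : {poly R} => size p) eq_ab.
  by rewrite /= !size_exp_XsubC => -[].
have : root (shifted_power a m) a.
  by rewrite rootE horner_exp hornerXsubC subrr expf_eq0 m_gt0 eqxx.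
rewrite eq_ab -eq_mn rootE horner_exp hornerXsubC expf_eq0 m_gt0 subr_eq0.
by move/eqP.
Qed.

(* The nodes lie in (-1, 0): the left-hand side of the identity is (2d+2)
   times the integral of (x - t)^(2d+1) over t in [-1, 0].  With nodes in
   (0, 1) the identity would fail, already for d = 0. *)
Theorem mainTheorem5 (R : realType) :
  (forall d : nat,
     exists (alpha a : 'I_d.+1 -> R),
       (forall i, -1 < a i < 0) /\
       ('X + 1) ^+ (2 * d + 2) - 'X ^+ (2 * d + 2) =
         \sum_(i < d.+1) alpha i *: shifted_power (a i) (2 * d + 1))
  /\
  (forall s : nat, (3 <= s)%N ->
     exists (a : 'I_s -> R) (e : 'I_s -> nat),
       [/\ injective (fun i => shifted_power (a i) (e i)),
           (forall i, (2 * s - 5 <= e i)%N) &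
           linearly_dependent (fun i => shifted_power (a i) (e i))]).
Proof.
split=> [d|s].
  have [x [_ x_in] [c eq_c]] := shifted_power_difference R d.
  by exists c, x; split=> // i; apply: x_in.
case: s => [|[|[|d]]] // _.
have [x [x_inj x_in] [c eq_c]] := shifted_power_difference R d.
(* The shifts are the nodes followed by -1 and 0, which take the exponent 2d+2. *)
pose y i := if (i < d.+1)%N then x i else if i == d.+1 then -1 else 0.
pose e i := if (i < d.+1)%N then (2 * d + 1)%N else (2 * d + 2)%N.
pose k i := if (i < d.+1)%N then c i else if i == d.+1 then -1 else 1.
exists y, e; split=> [i j|i|].
- have e_gt0 : (0 < e i)%N by rewrite /e addn1 addn2; case: ifP.
  move/(shifted_power_inj e_gt0) => eq_y; apply: ord_inj; move: eq_y.
  have lt_i := ltn_ord i; have lt_j := ltn_ord j.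
  have last_ord l : (l < d.+3)%N -> (d.+1 <= l)%N -> l <> d.+1 -> l = d.+2.
    move=> lt_l le_l /eqP ne_l; apply/eqP; rewrite eqn_leq -ltnS lt_l /=.
    by rewrite ltn_neqAle eq_sym ne_l.
  rewrite /y; case: ltnP => [/x_in/andP[gt_i i_lt]|le_i];
    case: ltnP => [/x_in/andP[gt_j j_lt]|le_j].
  + exact: x_inj.
  + by case: ifP => _ eq_x; move: gt_i i_lt; rewrite eq_x ltxx.
  + by case: ifP => _ eq_x; move: gt_j j_lt; rewrite -eq_x ltxx.
  case: eqP => [->|/(last_ord _ lt_i le_i) ->];
    case: eqP => [->|/(last_ord _ lt_j le_j) ->] // /eqP.
    by rewrite oppr_eq0 oner_eq0.
  by rewrite eq_sym oppr_eq0 oner_eq0.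
- have -> : (2 * d.+3 - 5 = 2 * d + 1)%N.
    by rewrite -addn3 mulnDr -addnBA.
  by rewrite /e; case: ifP; rewrite // leq_add2l.
have last_lt : (d.+2 < d.+1)%N = false by rewrite ltnNge leqnSn.
have last_eq : (d.+2 == d.+1) = false by rewrite eqn_leq ltnn.
exists k; first by exists ord_max; rewrite /k last_lt last_eq oner_eq0.
rewrite 2!big_ord_recr /= /k /y /e ltnn eqxx last_lt last_eq.
under eq_bigr do rewrite ltn_ord.
rewrite -eq_c /shifted_power polyCN opprK subr0 scaleN1r scale1r.
by rewrite addrAC subrK subrr.
Qed.
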